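(* Let $p\geq 1$. The $p$-energy game on graphs is superadditive. That is, for every graph $G=(V,E)$, setting $w_p(S)=\mathcal{E}_p(I(S))$ for $S\subset V$, one has $$w_p(S\cup T)\geq w_p(S)+w_p(T)$$ for all $S,T\subset V$ with $S\cap T=\emptyset$.
   Context: Graphs are finite, simple and undirected. For a graph $G$ with vertices $v_1,\dots,v_n$, the adjacency matrix $A(G)$ is the $n\times n$ matrix with $A_{ij}=1$ if $v_i$ and $v_j$ are adjacent and $A_{ij}=0$ otherwise. For a matrix $M$, $|M|=(MM^* )^{1/2}$. The $p$-energy of $G$ is $\mathcal{E}_p(G)=\operatorname{Tr}(|A(G)|^p)$, i.e. $\sum_i|\lambda_i|^p$ over the eigenvalues $\lambda_i$ of $A(G)$ counted with multiplicity (the empty graph has $p$-energy $0$). For $S\subset V$, $I(S)$ denotes the subgraph of $G$ induced by $S$. *)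

(* Defs.v *)
From HB Require Import structures.
From mathcomp Require Import all_boot all_order all_algebra.
From mathcomp Require Import spectral.
From mathcomp Require Import complex.
From mathcomp Require Import reals exp.

Set Implicit Arguments.
Unset Strict Implicit.
Unset Printing Implicit Defensive.

Import Order.TTheory GRing.Theory Num.Theory.
Local Open Scope ring_scope.
Local Open Scope complex_scope.
Local Open Scope sesquilinear_scope.

Record simple_graph := SimpleGraph {
  vertex :> finType;
  adj : rel vertex;
  adj_sym : symmetric adj;
  adj_irr : irreflexive adj
}.

Section Induced.
Variables (G : simple_graph) (S : {set G}).

Definition induced_adj : rel {x : G | x \in S} := [rel x y | adj (val x) (val y)].

Fact induced_adj_sym : symmetric induced_adj.
Proof. by move=> x y; apply: adj_sym. Qed.

Fact induced_adj_irr : irreflexive induced_adj.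
Proof. by move=> x; apply: adj_irr. Qed.

Definition induced : simple_graph := SimpleGraph induced_adj_sym induced_adj_irr.

End Induced.

Section Energy.
Variable R : realType.

(* The vertices are numbered v_i = enum_val i. *)
Definition adjmx (G : simple_graph) : 'M[R[i]]_#|G| :=
  \matrix_(i, j) (adj (enum_val i) (enum_val j))%:R.

(* Functional calculus f(A) = U^-1 diag(f(d_1), ..., f(d_n)) U for a Hermitian
   matrix A = U^-1 diag(d_1, ..., d_n) U, with U unitary.  The d_i are then
   real, so that nothing is lost by taking Re; the value is not meaningful for
   a matrix that is not Hermitian. *)
Definition hermfun (f : R -> R) n (A : 'M[R[i]]_n) : 'M[R[i]]_n :=
  invmx (spectralmx A)
  *m diag_mx (map_mx (fun z => (f (complex.Re z))%:C) (spectral_diag A))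
  *m spectralmx A.

(* |M| = (M M^* )^(1/2) *)
Definition absmx n (M : 'M[R[i]]_n) : 'M[R[i]]_n :=
  hermfun Num.sqrt (M *m M^t*).

(* Only for A positive semidefinite, where the eigenvalues are nonnegative. *)
Definition powmx n (A : 'M[R[i]]_n) (p : R) : 'M[R[i]]_n :=
  hermfun (fun x => powR x p) A.

(* The trace is a real number; complex.Re only changes its type to R. *)
Definition penergy (p : R) (G : simple_graph) : R :=
  complex.Re (\tr (powmx (absmx (adjmx G)) p)).

Definition penergy_game (p : R) (G : simple_graph) (S : {set G}) : R :=
  penergy p (induced S).

End Energy.

(* Main.v *)
(** Pinching.  Let A, B_S and B_T be the adjacency matrices of I(S :|: T), I(S)
    and I(T).  If J is the inclusion matrix of S into S :|: T, then
    B_S = J A J^*; diagonalizing A and B_S by unitary matrices U and P gives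
    a = V d V^* for the diagonal matrices d and a of their eigenvalues, where
    V = P J U^*.  So each eigenvalue a_j is the average of the d_k with weights
    |V_jk|^2, and |a_j|^p is at most the average of the |d_k|^p, by convexity.
    Summing over the eigenvalues of both B_S and B_T, the total weight of
    |d_k|^p is 1, because S and T partition S :|: T. *)

Require Import Defs.
From mathcomp Require Import all_boot all_order all_algebra.
From mathcomp Require Import spectral complex ring lra.
From mathcomp Require Import reals exp.

Set Implicit Arguments.
Unset Strict Implicit.
Unset Printing Implicit Defensive.

Import Order.TTheory GRing.Theory Num.Theory.
Local Open Scope ring_scope.
Local Open Scope complex_scope.
Local Open Scope sesquilinear_scope.

(** * Jensen's inequality for powers of absolute values *)

Section PowerMean.
Variable R : realType.

(* Young's inequality for x and m ^ (p - 1). *)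
Lemma powR_tangent (p x m : R) : 1 <= p -> 0 <= x -> 0 <= m ->
  powR m p + p * powR m (p - 1) * (x - m) <= powR x p.
Proof.
move=> p1 x0 m0; have p0 : 0 < p by apply: lt_le_trans p1.
have mp : powR m (p - 1) * m = powR m p.
  have [->|m_neq0] := eqVneq m 0; first by rewrite mulr0 powR0 ?gt_eqF.
  by rewrite -{2}(powRr1 m0) -powRD ?subrK // m_neq0 implybT.
(* At [p = 1] the conjugate exponent [p / (p - 1)] is infinite; there both sides equal [x]. *)
have [p_eq1|p_neq1] := eqVneq p 1.
  by move: mp; rewrite p_eq1 subrr powRr0 !powRr1 //; lra.
have p1' : 0 < p - 1 by rewrite subr_gt0 lt_neqAle eq_sym p_neq1.
have q0 : 0 < p / (p - 1) by rewrite divr_gt0.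
have := @conjugate_powR R x (powR m (p - 1)) p (p / (p - 1)) x0 (powR_ge0 _ _)
  p0 q0.
rewrite -powRrM mulrCA divff ?gt_eqF // mulr1 => young.
have /young : p^-1 + (p / (p - 1))^-1 = 1 by field; rewrite !gt_eqF.
rewrite -(ler_pM2l p0).
have -> : p * (powR x p / p + powR m p / (p / (p - 1))) =
    powR x p + (p - 1) * powR m p by field; rewrite !gt_eqF.
move: mp; set b := powR m (p - 1) => <-; lra.
Qed.

(** After the triangle inequality, the tangent bound at the weighted mean [m] of the absolute values
    is averaged with the weights [w]. *)
Lemma powR_sum_le (I : finType) (p : R) (w x : I -> R) : 1 <= p ->
  (forall i, 0 <= w i) -> \sum_i w i = 1 ->
  powR `|\sum_i w i * x i| p <= \sum_i w i * powR `|x i| p.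
Proof.
move=> p1 w0 w1; pose m := \sum_i w i * `|x i|.
have m0 : 0 <= m by apply: sumr_ge0 => i _; rewrite mulr_ge0.
apply: (@le_trans _ _ (powR m p)).
  rewrite ge0_ler_powR ?nnegrE ?(le_trans ler01 p1) //.
  apply: le_trans (ler_norm_sum _ _ _) _.
  by apply: ler_sum => i _; rewrite normrM (ger0_norm (w0 i)).
(* The linear terms cancel on average, by the choice of [m]. *)
have -> : powR m p =
    \sum_i w i * (powR m p + p * powR m (p - 1) * (`|x i| - m)).
  under eq_bigr do rewrite mulrDr mulrCA mulrBr.
  rewrite big_split /= -mulr_suml w1 mul1r -mulr_sumr sumrB -mulr_suml w1.
  by rewrite -/m mul1r subrr mulr0 addr0.
by apply: ler_sum => i _; rewrite ler_wpM2l ?powR_tangent.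
Qed.

End PowerMean.

(** * Spectral calculus and pinching for Hermitian matrices *)

Section HermitianTrace.
Variable R : realType.
Local Notation C := R[i].
Local Notation rdiag d := (diag_mx (map_mx (real_complex R) d)).

Lemma rdiagM n (d e : 'rV[R]_n) :
  rdiag d *m rdiag e = rdiag (\row_i (d 0 i * e 0 i)).
Proof.
rewrite mulmx_diag; congr diag_mx; apply/rowP => i.
by rewrite !mxE rmorphM.
Qed.

Lemma rdiag_adj n (d : 'rV[R]_n) : (rdiag d)^t* = rdiag d.
Proof.
rewrite tr_diag_mx; apply/matrixP => i j; rewrite !mxE.
by rewrite rmorphMn; congr (_ *+ _); apply: conjc_real.
Qed.

Lemma adjM m n k (A : 'M[C]_(m, n)) (B : 'M[C]_(n, k)) :
  (A *m B)^t* = B^t* *m A^t*.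
Proof. by rewrite trmx_mul map_mxM. Qed.

Lemma udiag_adj n (U : 'M[C]_n) (d : 'rV[R]_n) :
  (U^t* *m rdiag d *m U)^t* = U^t* *m rdiag d *m U.
Proof. by rewrite !adjM rdiag_adj trmxCK mulmxA. Qed.

(* The spectral decomposition chosen by spectralmx need not be (U, d), but
   s_i V_ij = V_ij d_j forces f(s_i) V_ij = V_ij f(d_j). *)
Lemma hermfunE f n (U : 'M[C]_n) (d : 'rV[R]_n) : U \is unitarymx ->
  hermfun f (U^t* *m rdiag d *m U) = U^t* *m rdiag (map_mx f d) *m U.
Proof.
move=> unU; set A := _ *m U.
have UU : U *m U^t* = 1%:M by apply/unitarymxP.
have UU' : U^t* *m U = 1%:M.
  by rewrite -invmx_unitary // mulVmx ?unitarymx_unit.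
have /orthomx_spectralP : A \is normalmx by apply/normalmxP; rewrite udiag_adj.
rewrite /hermfun; set P := spectralmx A; set s := spectral_diag A => defA.
have uP : P \in unitmx by apply: spectral_unit.
pose V := P *m U^t*.
have VU : P = V *m U by rewrite -mulmxA UU' mulmx1.
have sV : diag_mx s *m V = V *m rdiag d.
  have : P *m A *m U^t* = V *m rdiag d.
    by rewrite -[RHS]mulmx1 -UU /A /V !mulmxA.
  by rewrite {1}defA /V !mulmxA mulmxV // mul1mx => ->.
have fsV : diag_mx (map_mx (fun z => (f (complex.Re z))%:C) s) *m V =
    V *m rdiag (map_mx f d).
  move: (V) sV => W sW; apply/matrixP => i j; move/matrixP/(_ i j): sW.
  rewrite !mul_diag_mx !mul_mx_diag !mxE mulrC.
  have [-> _|Wij /(mulfI Wij) ->] := eqVneq (W i j) 0; first by rewrite mulr0 mul0r.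
  by rewrite mulrC.
have PV : invmx P *m V = U^t* by rewrite mulKmx.
by rewrite [X in _ *m X = _]VU mulmxA -(mulmxA (invmx P)) fsV mulmxA PV.
Qed.

Lemma hermitian_diagonalize n (A : 'M[C]_n) : A^t* = A ->
  exists (U : 'M[C]_n) (d : 'rV[R]_n),
    U \is unitarymx /\ A = U^t* *m rdiag d *m U.
Proof.
move=> Aadj.
have Aherm : A \is hermsymmx.
  by apply/is_hermitianmxP; rewrite expr0 scale1r.
have /orthomx_spectralP defA := hermitian_normalmx Aherm.
exists (spectralmx A), (map_mx (@complex.Re R) (spectral_diag A)).
split; first exact: spectral_unitarymx.
rewrite {1}defA invmx_unitary ?spectral_unitarymx //; congr (_ *m diag_mx _ *m _).
apply/rowP => i; rewrite !mxE RRe_real //.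
by have /mxOverP := hermitian_spectral_diag_real Aherm.
Qed.

(** [penergy] freed from graphs, so that pinching can be stated for Hermitian matrices. *)
Definition tr_abspow (p : R) n (A : 'M[C]_n) : R :=
  complex.Re (\tr (powmx (absmx A) p)).

(** The matrix times its adjoint is its square, with eigenvalues [d_i ^ 2], and the square root of
    [d_i ^ 2] is the absolute value of [d_i]. The same [U] serves both functional calculi. *)
Lemma tr_abspowE p n (U : 'M[C]_n) (d : 'rV[R]_n) : U \is unitarymx ->
  tr_abspow p (U^t* *m rdiag d *m U) = \sum_i powR `|d 0 i| p.
Proof.
move=> unU; have UU : U *m U^t* = 1%:M by apply/unitarymxP.
rewrite /tr_abspow /absmx udiag_adj.
have -> : U^t* *m rdiag d *m U *m (U^t* *m rdiag d *m U) =
    U^t* *m rdiag (\row_i (d 0 i * d 0 i)) *m U.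
  by rewrite -rdiagM !mulmxA mulmxtVK.
rewrite hermfunE // /powmx hermfunE // mxtrace_mulC mulmxA UU mul1mx.
rewrite mxtrace_diag raddf_sum; apply: eq_bigr => i _.
by rewrite !mxE /= -expr2 sqrtr_sqr.
Qed.

(** The norm of [C] has values in [C]; [complex.Re] turns squared moduli into weights in [R]. *)
Lemma Re_normsq (z : C) : (complex.Re (`|z| ^+ 2))%:C = z * z^*%R.
Proof. by rewrite RRe_real ?rpredX ?normr_real // normCK. Qed.

Lemma real_conj_rdiag m n (V : 'M[C]_(m, n)) (d : 'rV[R]_n) j :
  (V *m rdiag d *m V^t*) j j =
  (\sum_k complex.Re (`|V j k| ^+ 2) * d 0 k)%:C.
Proof.
rewrite mul_mx_diag !mxE [RHS]rmorph_sum; apply: eq_bigr => k _.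
rewrite !mxE rmorphM [X in _ = X * _]Re_normsq.
by rewrite mulrAC.
Qed.

Lemma mul_adj_diag m n (V : 'M[C]_(m, n)) j :
  (V *m V^t*) j j = (\sum_k complex.Re (`|V j k| ^+ 2))%:C.
Proof.
rewrite !mxE [RHS]rmorph_sum; apply: eq_bigr => k _.
by rewrite !mxE -Re_normsq.
Qed.

Lemma adj_mul_diag m n (V : 'M[C]_(m, n)) k :
  (V^t* *m V) k k = (\sum_j complex.Re (`|V j k| ^+ 2))%:C.
Proof.
rewrite !mxE [RHS]rmorph_sum; apply: eq_bigr => j _.
by rewrite !mxE mulrC -Re_normsq.
Qed.

(** The rows of [V] are unit vectors, so their squared moduli are the weights for Jensen. Of [V]
    only [V^t* *m V] is kept: its diagonal holds the column sums of the weights. *)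
Lemma compression_abspow_le p m n (U : 'M[C]_n) (d : 'rV[R]_n)
    (J : 'M[C]_(m, n)) : 1 <= p -> U \is unitarymx -> J \is unitarymx ->
  exists2 V : 'M[C]_(m, n), V^t* *m V = U *m (J^t* *m J) *m U^t* &
    tr_abspow p (J *m (U^t* *m rdiag d *m U) *m J^t*) <=
    \sum_j \sum_k complex.Re (`|V j k| ^+ 2) * powR `|d 0 k| p.
Proof.
move=> p1 unU unJ; set B := J *m _ *m _.
have Badj : B^t* = B by rewrite /B !(adjM, trmxCK, rdiag_adj) !mulmxA.
have [P [a [unP defB]]] := hermitian_diagonalize Badj.
have PP' : P^t* *m P = 1%:M.
  by rewrite -invmx_unitary // mulVmx ?unitarymx_unit.
pose V := P *m J *m U^t*.
have unV : V \is unitarymx.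
  by rewrite !mul_unitarymx ?trmxC_unitary.
have VdV : V *m rdiag d *m V^t* = rdiag a.
  have -> : rdiag a = P *m B *m P^t*.
    by rewrite defB !mulmxA (unitarymxP unP) mul1mx -mulmxA (unitarymxP unP) mulmx1.
  by rewrite /B /V !(adjM, trmxCK) !mulmxA.
exists V.
  by rewrite /V !(adjM, trmxCK) !mulmxA mulmxKtV // -!mulmxA (mulmxA P^t*) PP'
    mul1mx.
rewrite defB tr_abspowE //; apply: ler_sum => j _.
have -> : a 0 j = \sum_k complex.Re (`|V j k| ^+ 2) * d 0 k.
  apply: (@complexI R); rewrite -real_conj_rdiag VdV !mxE eqxx mulr1n //.
apply: powR_sum_le => // [k|].
  by rewrite -ler0c RRe_real ?rpredX ?normr_real // exprn_ge0.
by apply: (@complexI R); rewrite -mul_adj_diag (unitarymxP unV) mxE eqxx.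
Qed.

(** The two compressions are the diagonal blocks of [A] in an orthogonal splitting of the space. *)
Lemma pinching_abspow_le p m1 m2 n (A : 'M[C]_n)
    (J1 : 'M[C]_(m1, n)) (J2 : 'M[C]_(m2, n)) :
  1 <= p -> A^t* = A -> J1 \is unitarymx -> J2 \is unitarymx ->
  J1^t* *m J1 + J2^t* *m J2 = 1%:M ->
  tr_abspow p (J1 *m A *m J1^t*) + tr_abspow p (J2 *m A *m J2^t*) <=
  tr_abspow p A.
Proof.
move=> p1 Aadj unJ1 unJ2 J12.
have [U [d [unU ->]]] := hermitian_diagonalize Aadj.
have [V1 V1V1 le1] := compression_abspow_le d p1 unU unJ1.
have [V2 V2V2 le2] := compression_abspow_le d p1 unU unJ2.
apply: le_trans (lerD le1 le2) _; rewrite tr_abspowE //.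
(* Summing over [j] first collects the total weight of each [d_k]. *)
rewrite (exchange_big_dep xpredT) //= [X in _ + X](exchange_big_dep xpredT) //=.
rewrite -big_split /=; apply: ler_sum => k _.
rewrite -!mulr_suml -mulrDl.
suff -> : \sum_j complex.Re (`|V1 j k| ^+ 2) + \sum_j complex.Re (`|V2 j k| ^+ 2)
    = 1 by rewrite mul1r.
apply: (@complexI R); transitivity ((V1^t* *m V1 + V2^t* *m V2) k k).
  by rewrite rmorphD [RHS]mxE !adj_mul_diag.
rewrite V1V1 V2V2 -mulmxDl -mulmxDr J12 mulmx1 (unitarymxP unU).
by rewrite mxE eqxx.
Qed.

End HermitianTrace.

(** * Induced subgraphs as compressions *)

Section Inclusion.
Variables (R : realType) (G : simple_graph).
Local Notation C := R[i].

(** The vertices of the two subgraphs have different subtypes, hence the comparison in [G] through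
    [val]. *)
Definition inclmx (S W : {set G}) : 'M[C]_(#|induced S|, #|induced W|) :=
  \matrix_(i, j) (val (enum_val i) == val (enum_val j))%:R.

Lemma adj_nat_mx m n (b : 'I_m -> 'I_n -> bool) :
  (\matrix_(i, j) (b i j)%:R : 'M[C]_(m, n))^t* =
  \matrix_(i, j) (b j i)%:R.
Proof. by apply/matrixP => i j; rewrite !mxE rmorph_nat. Qed.

Lemma adjmx_adj (H : simple_graph) : (adjmx R H)^t* = adjmx R H.
Proof.
by rewrite adj_nat_mx; apply/matrixP => i j; rewrite !mxE adj_sym.
Qed.

(** Evaluates the entries of products with [inclmx]; [F] lives on all of [G] so that the sum can be
    reindexed. *)
Lemma sum_induced_delta (W : {set G}) (x : G) (F : G -> C) :
  \sum_(k < #|induced W|) (x == val (enum_val k))%:R * F (val (enum_val k)) =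
  (x \in W)%:R * F x.
Proof.
rewrite -(@big_enum_val _ _ _ (induced W) predT
  (fun y => (x == val y)%:R * F (val y))) /=.
rewrite -(@big_sub _ _ _ _ (mem W) (fun y => (x == y)%:R * F y)) /=.
have [xW|xW] := boolP (x \in W).
  rewrite (bigD1 x) //= eqxx big1 ?addr0 // => y /andP[_ /negPf].
  by rewrite eq_sym => ->; rewrite mul0r.
rewrite big1 ?mul0r // => y yW; case: eqP => [xy|]; last by rewrite mul0r.
by rewrite xy yW in xW.
Qed.

Lemma inclmx_unitary (S W : {set G}) : S \subset W ->
  inclmx S W \is unitarymx.
Proof.
move=> sSW; apply/unitarymxP/matrixP => i j; rewrite adj_nat_mx !mxE.
under eq_bigr do rewrite !mxE.
rewrite (sum_induced_delta W _ (fun y => (val (enum_val j) == y)%:R)).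
rewrite (subsetP sSW) ?(valP (enum_val i)) // mul1r.
by rewrite (inj_eq val_inj) (inj_eq enum_val_inj) eq_sym.
Qed.

Lemma adjmx_induced (S W : {set G}) : S \subset W ->
  inclmx S W *m adjmx R (induced W) *m (inclmx S W)^t* = adjmx R (induced S).
Proof.
move=> sSW; apply/matrixP => i j; rewrite adj_nat_mx !mxE.
under eq_bigr => k _.
  rewrite !mxE; under eq_bigr do rewrite !mxE /=.
  rewrite (sum_induced_delta W _ (fun y => (adj y (val (enum_val k)))%:R)).
  rewrite (subsetP sSW) ?(valP (enum_val i)) // mul1r mulrC.
  over.
rewrite (sum_induced_delta W _ (fun y => (adj (val (enum_val i)) y)%:R)).
by rewrite (subsetP sSW) ?(valP (enum_val j)) // mul1r.
Qed.

(** The summands are the coordinate projections onto [S] and [T], and each vertex of the union lies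
    in exactly one of them. *)
Lemma inclmx_partition (S T : {set G}) : S :&: T = set0 ->
  (inclmx S (S :|: T))^t* *m inclmx S (S :|: T) +
  (inclmx T (S :|: T))^t* *m inclmx T (S :|: T) = 1%:M.
Proof.
move=> dST; apply/matrixP => i j; rewrite !adj_nat_mx !mxE.
under eq_bigr do rewrite !mxE (eq_sym _ (val (enum_val i))).
under [X in _ + X]eq_bigr do rewrite !mxE (eq_sym _ (val (enum_val i))).
rewrite !(sum_induced_delta _ _ (fun y => (y == val (enum_val j))%:R)) -mulrDl.
rewrite (inj_eq val_inj) (inj_eq enum_val_inj).
have := valP (enum_val i); move/setP/(_ (val (enum_val i))): dST.
by rewrite !inE; do 2![case: (_ \in _)] => //= _ _; rewrite ?(addr0, add0r) mul1r.
Qed.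

End Inclusion.

Theorem proposition4p1 (R : realType) (p : R) (hp : 1 <= p)
    (G : simple_graph) (S T : {set G}) (hST : S :&: T = set0) :
  penergy_game p S + penergy_game p T <= penergy_game p (S :|: T).
Proof.
have := pinching_abspow_le hp (adjmx_adj R (induced (S :|: T)))
  (inclmx_unitary R (subsetUl S T)) (inclmx_unitary R (subsetUr S T))
  (inclmx_partition R hST).
(* What remains agrees with the goal by unfolding [penergy_game] and [tr_abspow]. *)
by rewrite !adjmx_induced ?subsetUl ?subsetUr.
Qed.
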